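(* Let $\rho\in(0,\varepsilon/2)$. Let the data-generating distribution $\mathbb{P}_0$ of $(\tilde\xi_1,\tilde\xi_2)$ be the two-point distribution with $\mathbb{P}_0[(\tilde\xi_1,\tilde\xi_2)=(1,1)]=\rho$ and $\mathbb{P}_0[(\tilde\xi_1,\tilde\xi_2)=(-1,1)]=1-\rho$. Consider the distributionally robust chance constrained program $$(\star)\qquad\inf_{x\in\mathbb{R}}\; -x\quad\text{s.t.}\quad \mathbb{P}[x>\tilde\xi_1,\;x<\tilde\xi_2]\ge 1-\varepsilon\;\;\forall\mathbb{P}\in\mathcal{F}(\theta),\quad 0\le x\le 1.$$ Then, as $N\to\infty$, with probability going to $1$, we have that the Bonferroni approximation to $(\star)$ that replaces the joint chance constraint with $$\mathbb{P}[x>\tilde\xi_1]\ge 1-\varepsilon_1\;\forall\mathbb{P}\in\mathcal{F}(\theta),\qquad \mathbb{P}[x<\tilde\xi_2]\ge 1-\varepsilon_2\;\forall\mathbb{P}\in\mathcal{F}(\theta)$$ becomes exact (that is, its optimal value equals the optimal value of $(\star)$) if the risk thresholds $(\varepsilon_1,\varepsilon_2)$ are sufficiently close to $(\varepsilon,0)$.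
   Context: Risk threshold $\varepsilon\in(0,1)$. The samples $\hat{\boldsymbol{\xi}}_1,\dots,\hat{\boldsymbol{\xi}}_N\in\mathbb{R}^2$ are drawn independently from $\mathbb{P}_0$; ''with probability going to $1$'' refers to the sampling. $\hat{\mathbb{P}}=\frac1N\sum_{i=1}^N\delta_{\hat{\boldsymbol{\xi}}_i}$ is the empirical distribution and $\mathcal{F}(\theta)=\{\mathbb{P}\in\mathcal{P}(\mathbb{R}^2) : d_{\rm W}(\mathbb{P},\hat{\mathbb{P}})\le\theta\}$, where $\mathcal{P}(\mathbb{R}^2)$ is the set of probability distributions on $\mathbb{R}^2$ and $d_{\rm W}(\mathbb{P}_1,\mathbb{P}_2)$ is the type-1 Wasserstein distance (infimum of $\mathbb{E}[\|\tilde{\boldsymbol{\xi}}-\tilde{\boldsymbol{\xi}}'\|]$ over all joint distributions with marginals $\mathbb{P}_1,\mathbb{P}_2$) for a $p$-norm $\|\cdot\|$ with $p\in\mathbb{Q}$, $p>1$. The radius $\theta=\theta_N\ge0$ depends on $N$ and decays to zero as $N\to\infty$, and it is assumed that in the limit $N\to\infty$ the set $\mathcal{F}(\theta_N)$ contains $\mathbb{P}_0$ with probability one. Bonferroni risk thresholds are numbers $\varepsilon_1,\varepsilon_2\ge0$ with $\varepsilon_1+\varepsilon_2=\varepsilon$.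
   Formalization: Equality of the optimal values fails at finite N, as the radius must be positive; proved instead: for every δ>0, with probability going to 1, the two values are finite and differ by at most δ, for thresholds close to (ε,0) with ε₂>0 (ε₂=0 makes the approximation infeasible). *)

(* Defs.v *)
From HB Require Import structures.
From mathcomp Require Import all_boot all_order all_algebra.
From mathcomp Require Import all_classical all_reals all_analysis.

Set Implicit Arguments.
Unset Strict Implicit.
Unset Printing Implicit Defensive.

Import Order.TTheory GRing.Theory Num.Theory.
Import numFieldNormedType.Exports.

Local Open Scope classical_set_scope.
Local Open Scope ring_scope.

Section Sampling.
Context {d d' : measure_display} {Omega : measurableType d}
  {T : measurableType d'} {R : realType}.
Variable Pr : probability Omega R.

Definition mutually_independent (X : nat -> {RV Pr >-> T}) : Prop :=
  forall (J : seq nat) (A : nat -> set T), uniq J ->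
    (forall i, measurable (A i)) ->
    Pr (\big[setI/setT]_(i <- J) (X i @^-1` A i)) =
    (\prod_(i <- J) Pr (X i @^-1` A i))%E.

Definition iid (P0 : probability T R) (X : nat -> {RV Pr >-> T}) : Prop :=
  mutually_independent X /\
  forall i (A : set T), measurable A -> distribution Pr (X i) A = P0 A.

(* The event A N holds with probability going to 1 as N tends to infinity.
   This is Pr (A N) --> 1 for measurable A N; inner approximation by measurable
   events gives a meaning without a measurability assumption on A N. *)
Definition with_probability_going_to_1 (A : nat -> set Omega) : Prop :=
  exists E : nat -> set Omega,
    [/\ forall N, measurable (E N), forall N, E N `<=` A N &
        (fun N => Pr (E N)) @ \oo --> (1%:E : \bar R)].

(* (1/N) (dirac (xi 0) + ... + dirac (xi N.-1)); the zero measure for N = 0. *)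
Definition empirical (N : nat) (xi : nat -> T) :
    {measure set T -> \bar R} :=
  mscale (N%:R^-1)%:nng (msum (fun i => \d_(xi i)) N).

End Sampling.

Section Wasserstein.
Context {R : realType}.
Implicit Types P Q : {measure set (R * R)%type -> \bar R}.

Definition pnorm (p : rat) (v : R * R) : R :=
  (`|v.1| `^ ratr p + `|v.2| `^ ratr p) `^ (ratr p)^-1.

Definition coupling P Q (pi : probability ((R * R) * (R * R))%type R) : Prop :=
  forall A : set (R * R), measurable A ->
    pi (fst @^-1` A) = P A /\ pi (snd @^-1` A) = Q A.

Definition wasserstein (p : rat) P Q : \bar R :=
  ereal_inf [set (\int[pi]_z (pnorm p (z.1.1 - z.2.1, z.1.2 - z.2.2))%:E)%E
            | pi in coupling P Q].

Definition wasserstein_ball (p : rat) (Phat : {measure set (R * R)%type -> \bar R})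
    (theta : R) : set (probability (R * R)%type R) :=
  [set P | (wasserstein p P Phat <= theta%:E)%E].

End Wasserstein.

Section ChanceConstrainedProgram.
Context {R : realType}.
Variable F : set (probability (R * R)%type R).

Definition robust_chance (alpha : R) (S : set (R * R)) : Prop :=
  forall P : probability (R * R)%type R, F P -> (alpha%:E <= P S)%E.

Definition joint_feasible (eps : R) : set R :=
  [set x | robust_chance (1 - eps) [set xi | x > xi.1 /\ x < xi.2] /\
           0 <= x <= 1].

Definition bonferroni_feasible (eps1 eps2 : R) : set R :=
  [set x | [/\ robust_chance (1 - eps1) [set xi | x > xi.1],
               robust_chance (1 - eps2) [set xi | x < xi.2] &
               0 <= x <= 1]].

(* inf of -x over X; it is +oo when X is empty. *)
Definition optimal_value (X : set R) : \bar R :=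
  ereal_inf [set (- x)%:E | x in X].

End ChanceConstrainedProgram.

(* The Bonferroni approximation is exact up to delta. The slack is needed at
   finite N: if a fraction r < eps1 of the samples is (1, 1), the others being
   (-1, 1), then for a small radius theta > 0 the two optimal values are
   -1 + theta / eps2 and -1 + theta / (eps - r), which only agree in the limit
   theta --> 0. The gap to an infeasible
   program is infinite: +oo - +oo is -oo, of absolute value +oo, so the
   inequality forces both optimal values to be finite. *)
Definition bonferroni_exact_up_to {R : realType}
    (F : set (probability (R * R)%type R)) (eps eps1 eps2 delta : R) : Prop :=
  (`| optimal_value (bonferroni_feasible F eps1 eps2) -
      optimal_value (joint_feasible F eps) | <= delta%:E)%E.

(* Main.v *)
Require Import Defs.
From mathcomp Require Import all_boot all_order all_algebra.
From mathcomp Require Import all_classical all_reals all_analysis.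
From mathcomp Require Import measurable_realfun lra.

Set Implicit Arguments.
Unset Strict Implicit.
Unset Printing Implicit Defensive.

Import Order.TTheory GRing.Theory Num.Theory.
Import numFieldNormedType.Exports.

Local Open Scope classical_set_scope.
Local Open Scope ring_scope.

(** The optimal value of both programs is at least [-1], since [x <= 1], and
    a point feasible for the Bonferroni approximation is feasible for the
    joint program by the union bound. Hence exactness up to [delta] follows
    as soon as one point [x >= 1 - delta] satisfies the two individual robust
    chance constraints ([exact_of_feasible]).

    Such a point is [x = 1 - t] with [t > 0] small. Moving mass across a gap
    [s] costs at least [s] per unit of mass, so the tails
    [c <= f] and [c - s <= f] of two distributions at Wasserstein distance at
    most [th] satisfy a tail inequality with error [th / s], for each
    nonexpansive [f] ([wasserstein_superlevel]). Going from a
    distribution [P] of the ball to the empirical distribution and from there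
    to [P0], which belongs to the ball with probability going to 1, bounds a
    tail of [P] by a tail of [P0] with error [2 th / s] ([ball_superlevel]).
    Applied to the first coordinate this gives
    [P (xi1 >= x) <= rho + 2 th / s], and applied to the opposite of the second
    one [P (xi2 <= x) <= 2 th / s], because [P0] gives mass at most [rho] to
    [xi1 > -1] and none to [xi2 < 1]. As [th] tends to 0 with [s] fixed, these
    bounds fall below [eps1] and [eps2] provided that [eps1 > rho], which holds
    once [eps1] is within [eps / 2] of [eps], as [rho < eps / 2].

    Probability enters only through the coverage of [P0] by the ball: on that
    event, for large [N], exactness is a deterministic fact. The coverage
    itself bounds, through the same tail inequality, the fraction of the
    samples that are near [(1, 1)]. *)

(** * Tails and transport plans *)

Lemma measurable_superlevel d (T : measurableType d) (R : realType)
    (f : T -> R) (c : R) :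
  measurable_fun setT f -> measurable [set a | c <= f a].
Proof.
move=> mf; rewrite (_ : [set a | c <= f a] = setT `&` f @^-1` `[c, +oo[).
  by apply: mf => //; exact: measurable_itv.
by rewrite setTI; apply/seteqP; split => a /=; rewrite in_itv /= andbT.
Qed.

Lemma le_probability_setC d (T : measurableType d) (R : realType)
    (P : probability T R) (A : set T) (e : R) : measurable A ->
  ((1 - e)%:E <= P A)%E = (P (~` A) <= e%:E)%E.
Proof.
move=> mA; rewrite probability_setC //.
have /fineK <- : P A \is a fin_num by exact: fin_num_measure.
by rewrite -EFinB !lee_fin; apply/idP/idP => h; lra.
Qed.

(** Markov's inequality for the transport cost: the plan pays at least [s] on
    [U `\` V], and [U] is contained in the union of [V] and [U `\` V]. *)
Lemma coupling_markov d (T : measurableType d) (R : realType)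
    (pi : probability T R) (cost : T -> R) (U V : set T) (s : R) :
  0 < s -> measurable_fun setT cost -> (forall z, 0 <= cost z) ->
  measurable U -> measurable V -> (forall z, U z -> ~ V z -> s <= cost z) ->
  (pi U <= pi V + s^-1%:E * \int[pi]_z (cost z)%:E)%E.
Proof.
move=> s0 mc c0 mU mV sep.
have mUV : measurable (U `\` V) by exact: measurableD.
have mcE : measurable_fun setT (fun z => (cost z)%:E) by exact/measurable_EFinP.
have h : (s%:E * pi (U `\` V) <= \int[pi]_z (cost z)%:E)%E.
  rewrite -integral_cst //.
  apply: (@le_trans _ _ (\int[pi]_(z in U `\` V) (cost z)%:E)%E).
    apply: ge0_le_integral => //.
    - by move=> z _; rewrite lee_fin ltW.
    - exact: measurable_funTS.
    - by move=> z [Uz Vz]; rewrite lee_fin; exact: sep.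
  by apply: ge0_subset_integral => // z _; rewrite lee_fin.
apply: (@le_trans _ _ (pi V + pi (U `\` V))%E).
  apply: (le_trans _ (measureU2 _ _ _)) => //.
  apply: le_measure; rewrite ?inE //; first exact: measurableU.
  by move=> z Uz; case: (pselect (V z)) => Vz; [left|right].
by rewrite leeD2l // lee_pdivlMl.
Qed.

(** * The Wasserstein distance and tails of nonexpansive functions *)

Section Pnorm.
Context {R : realType}.
Variable p : rat.

Definition pdist (a b : R * R) : R := pnorm p (a.1 - b.1, a.2 - b.2).

Lemma measurable_pdist :
  measurable_fun setT (fun z : (R * R) * (R * R) => pdist z.1 z.2).
Proof.
rewrite /pdist /pnorm /=.
apply: measurableT_comp (measurable_powR _) _.
by apply: measurable_funD => /=; apply: measurableT_comp (measurable_powR _) _;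
  (apply: measurableT_comp; first exact: normr_measurable);
  apply: measurable_funB; do 2?[apply: measurableT_comp => //].
Qed.

(** Each coordinate is recovered from its own term [(x `^ p) `^ p^-1] of the
    norm; the other term only increases it. *)
Lemma le_pnorm (x : R) (v : R * R) : 0 < p ->
  x = `|v.1| \/ x = `|v.2| -> x <= pnorm p v.
Proof.
move=> p0 xv; have x0 : 0 <= x by case: xv => ->.
have q0 : 0 < ratr p :> R by rewrite ltr0q.
rewrite -[leLHS]powRr1 // -(divff (lt0r_neq0 q0)) powRrM.
apply: ge0_ler_powR; rewrite ?invr_ge0 ?nnegrE ?addr_ge0 ?powR_ge0 ?(ltW q0) //.
by case: xv => ->; rewrite ?lerDl ?lerDr powR_ge0.
Qed.

Definition nonexpansive (f : R * R -> R) :=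
  forall a b, `|f a - f b| <= pdist a b.

Lemma nonexpansive_fst : 0 < p -> nonexpansive fst.
Proof. by move=> p0 a b; apply: le_pnorm => //; left. Qed.

Lemma nonexpansiveN_snd : 0 < p -> nonexpansive (fun a => - a.2).
Proof.
by move=> p0 a b; rewrite -opprD normrN; apply: le_pnorm => //; right.
Qed.

(** A plan moves mass from [c <= f] to [f < c - s] only over distances at
    least [s], in either direction, so that [coupling_markov] bounds this mass;
    the slack [e] in the proof makes near-optimal plans sufficient. *)
Lemma wasserstein_superlevel (P Q : {measure set (R * R)%type -> \bar R})
    (th s c : R) (f : R * R -> R) :
  0 < s -> measurable_fun setT f -> nonexpansive f ->
  (wasserstein p P Q <= th%:E)%E ->
  (P [set a | (c <= f a)%R] <= Q [set a | (c - s <= f a)%R] + (th / s)%:E)%E /\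
  (Q [set a | (c <= f a)%R] <= P [set a | (c - s <= f a)%R] + (th / s)%:E)%E.
Proof.
move=> s0 mf lf W.
suff main e : 0 < e -> exists2 pi, coupling P Q pi &
    (s^-1%:E * \int[pi]_z (pdist z.1 z.2)%:E <= (th / s)%:E + e%:E)%E.
  have mfst : measurable_fun setT (f \o (@fst _ (R * R)%type)).
    exact: measurableT_comp.
  have msnd : measurable_fun setT (f \o (@snd (R * R)%type _)).
    exact: measurableT_comp.
  have mA t := measurable_superlevel t mf.
  split; apply/lee_addgt0Pr => e /main[pi cpi le_e].
    rewrite -(cpi _ (mA c)).1 -(cpi _ (mA (c - s))).2 -addeA.
    apply: le_trans (leeD2l _ le_e); apply: coupling_markov => //.
    - exact: measurable_pdist.
    - by move=> z; exact: powR_ge0.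
    - exact: measurable_superlevel mfst.
    - exact: measurable_superlevel msnd.
    move=> z /= cz /negP; rewrite -ltNge => zc.
    by apply: le_trans (lf _ _); rewrite ler_normr; apply/orP; left; lra.
  rewrite -(cpi _ (mA c)).2 -(cpi _ (mA (c - s))).1 -addeA.
  apply: le_trans (leeD2l _ le_e); apply: coupling_markov => //.
  - exact: measurable_pdist.
  - by move=> z; exact: powR_ge0.
  - exact: measurable_superlevel msnd.
  - exact: measurable_superlevel mfst.
  move=> z /= cz /negP; rewrite -ltNge => zc.
  by apply: le_trans (lf _ _); rewrite ler_normr; apply/orP; right; lra.
move=> e0; have : (wasserstein p P Q < (th + e * s)%:E)%E.
  by rewrite (le_lt_trans W) // lte_fin ltrDl mulr_gt0.
case/ereal_inf_lt => _ [pi cpi <-] /ltW le_pi; exists pi => //.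
by rewrite lee_pdivrMl // -EFinD -EFinM mulrDr mulrCA divff ?gt_eqF // mulr1
  (mulrC s e).
Qed.

(** Two members of the ball are compared through its centre: the tail
    inequality from [P] to [Phat] and the one from [Phat] to [Q] compose, the
    gaps and the errors adding up. *)
Lemma ball_superlevel (Phat : {measure set (R * R)%type -> \bar R})
    (P Q : probability (R * R)%type R) (th s c : R) (f : R * R -> R) :
  0 < s -> measurable_fun setT f -> nonexpansive f ->
  wasserstein_ball p Phat th P -> wasserstein_ball p Phat th Q ->
  (P [set a | (c <= f a)%R] <=
   Q [set a | (c - s - s <= f a)%R] + (th / s + th / s)%:E)%E.
Proof.
move=> s0 mf lf WP WQ.
have [+ _] := wasserstein_superlevel c s0 mf lf WP.
have [_ +] := wasserstein_superlevel (c - s) s0 mf lf WQ.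
move=> h1 h2; apply: le_trans h2 _.
by rewrite EFinD addeA leeD2r.
Qed.

End Pnorm.

(** * The joint program and its Bonferroni approximation *)

Section Programs.
Context {R : realType}.
Variable F : set (probability (R * R)%type R).

Let mlt1 (x : R) : measurable [set a : R * R | x > a.1].
Proof.
rewrite (_ : mkset _ = ~` [set a | x <= a.1]).
  by apply: measurableC; exact: measurable_superlevel.
by apply/seteqP; split => a /=; rewrite ltNge => /negP.
Qed.

Let mlt2 (x : R) : measurable [set a : R * R | x < a.2].
Proof.
rewrite (_ : mkset _ = ~` [set a | - x <= - a.2]).
  by apply: measurableC; apply: measurable_superlevel; exact: measurable_funN.
by apply/seteqP; split => a /=; rewrite lerN2 ltNge => /negP.
Qed.

Lemma bonferroni_sub_joint (eps eps1 eps2 : R) : eps1 + eps2 = eps ->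
  bonferroni_feasible F eps1 eps2 `<=` joint_feasible F eps.
Proof.
move=> <- x [h1 h2 x01]; split => // P FP.
rewrite (_ : mkset _ = [set a | x > a.1] `&` [set a | x < a.2]) //.
rewrite le_probability_setC; last exact: measurableI.
have := h1 _ FP; have := h2 _ FP.
rewrite !le_probability_setC // => k2 k1.
rewrite setCI; apply: le_trans (measureU2 _ _ _) _; try exact: measurableC.
by rewrite EFinD leeD.
Qed.

(** The violation events are superlevel sets of [fst] and of the opposite of
    [snd], two nonexpansive functions; this is the form that
    [ball_superlevel] bounds. *)
Lemma bonferroni_feasible_tails (eps1 eps2 x : R) : 0 <= x <= 1 ->
  (forall P, F P -> P [set a | (x <= a.1)%R] <= eps1%:E)%E ->
  (forall P, F P -> P [set a | (- x <= - a.2)%R] <= eps2%:E)%E ->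
  bonferroni_feasible F eps1 eps2 x.
Proof.
move=> x01 h1 h2; split=> // P FP; rewrite le_probability_setC //.
  rewrite (_ : ~` _ = [set a | x <= a.1]); first exact: h1.
  by apply/seteqP; split => a /=; rewrite leNgt => /negP.
rewrite (_ : ~` _ = [set a | - x <= - a.2]); first exact: h2.
by apply/seteqP; split => a /=; rewrite lerN2 leNgt => /negP.
Qed.

(** Feasible sets lie in [[0, 1]], so [-1] bounds both optimal values from
    below, and they are ordered by [bonferroni_sub_joint]; a feasible point
    near [1] then squeezes both into [[-1, -1 + delta]]. *)
Lemma exact_of_feasible (eps eps1 eps2 delta x : R) : eps1 + eps2 = eps ->
  1 - delta <= x -> bonferroni_feasible F eps1 eps2 x ->
  bonferroni_exact_up_to F eps eps1 eps2 delta.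
Proof.
move=> e12 dx Bx; rewrite /bonferroni_exact_up_to.
have BJ := bonferroni_sub_joint e12.
set B := optimal_value _; set J := optimal_value _.
have J1 : ((-1)%:E <= J)%E.
  by apply/ereal_infP => _ [y [_ /andP[_ y1]] <-]; rewrite lee_fin lerN2.
have JB : (J <= B)%E by apply: ereal_inf_le_tmp; exact: image_subset.
have Bd : (B <= (-1 + delta)%:E)%E.
  apply: ge_ereal_inf; exists (- x)%:E; first by exists x.
  by rewrite lee_fin; lra.
have := le_trans J1 JB; have := le_trans JB Bd.
move: B J J1 JB Bd => [b||] [j||] //; rewrite !lee_fin => *.
by rewrite ler_norml; lra.
Qed.

End Programs.

(** * Events with probability going to 1 *)

Lemma near_with_probability (R : realType) d (Omega : measurableType d)
    (Pr : probability Omega R) (A B : nat -> set Omega) :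
  with_probability_going_to_1 Pr A -> (\forall N \near \oo, A N `<=` B N) ->
  with_probability_going_to_1 Pr B.
Proof.
move=> [E [mE EA E1]] [M _ AB].
exists (fun N => if (M <= N)%N then E N else set0); split.
- by move=> N; case: ifP.
- move=> N; by case: ifP => [MN w /EA /(AB _ MN)|_ w []].
- apply: cvg_trans E1; apply: near_eq_cvg.
  by exists M => // N /= ->.
Qed.

(** * Tails of the two-point distribution *)

Section TwoPoint.
Context {R : realType}.
Variables (P0 : probability (R * R)%type R) (rho : R).
Hypothesis hP0_1 : P0 [set (1, 1)] = rho%:E.
Hypothesis hP0_2 : P0 [set (-1, 1)] = (1 - rho)%:E.

Let mpt (a : R * R) : measurable [set a].
Proof.
case: a => a b; rewrite (_ : [set _] = [set a] `*` [set b]).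
  exact: measurableX.
by apply/seteqP; split => [_ ->|[x y] [/= -> ->]].
Qed.

Lemma two_point_fst (c : R) : - 1 < c ->
  (P0 [set a | (c <= a.1)%R] <= rho%:E)%E.
Proof.
move=> c1; apply: (@le_trans _ _ (P0 (~` [set (-1, 1)]))).
  apply: le_measure; rewrite ?inE; [|exact/measurableC|].
    exact: measurable_superlevel.
  by move=> a /= ca ae; move: ca; rewrite ae /= leNgt c1.
by rewrite -le_probability_setC // hP0_2.
Qed.

Lemma two_point_snd (c : R) : - 1 < c -> P0 [set a | c <= - a.2] = 0%E.
Proof.
move=> c1; apply/eqP; rewrite eq_le measure_ge0 andbT.
pose S : set (R * R) := [set (1, 1)] `|` [set (-1, 1)].
have mS : measurable S by exact: measurableU.
apply: (@le_trans _ _ (P0 (~` S))).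
  apply: le_measure; rewrite ?inE; [|exact/measurableC|].
    by apply: measurable_superlevel; exact: measurable_funN.
  by move=> a /= ca [] ae; move: ca; rewrite ae /= leNgt c1.
rewrite -(le_probability_setC P0 0 mS) measureU //; last first.
  by apply/seteqP; split => // a [-> []]; lra.
by rewrite [X in (X + _)%E]hP0_1 [X in (_ + X)%E]hP0_2 -EFinD lee_fin; lra.
Qed.

End TwoPoint.

Theorem proposition18 (R : realType) (p : rat) (hp : 1 < p)
    (eps : R) (heps : 0 < eps < 1)
    (rho : R) (hrho : 0 < rho < eps / 2)
    (P0 : probability (R * R)%type R)
    (hP0_1 : P0 [set (1, 1)] = rho%:E)
    (hP0_2 : P0 [set (-1, 1)] = (1 - rho)%:E)
    (d : measure_display) (Omega : measurableType d)
    (Pr : probability Omega R)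
    (xi : nat -> {RV Pr >-> (R * R)%type}) (hxi : iid P0 xi)
    (theta : nat -> R) (htheta_ge0 : forall N, 0 <= theta N)
    (htheta0 : theta @ \oo --> (0 : R))
    (hcover : with_probability_going_to_1 Pr (fun N =>
       [set w | wasserstein_ball p (empirical N (fun i => xi i w)) (theta N)
                  P0])) :
  exists eta : R, 0 < eta /\
    forall eps1 eps2 : R,
      0 <= eps1 -> 0 < eps2 -> eps1 + eps2 = eps ->
      `|eps1 - eps| < eta -> `|eps2 - 0| < eta ->
      forall delta : R, 0 < delta ->
        with_probability_going_to_1 Pr (fun N =>
          [set w | bonferroni_exact_up_to
             (wasserstein_ball p (empirical N (fun i => xi i w)) (theta N))
             eps eps1 eps2 delta]).
Proof.
move: heps hrho => /andP[eps0 eps1] /andP[rho0 rho_eps].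
(* Within this distance of [eps], [eps1] exceeds [rho]. *)
exists (eps / 2); split; first by rewrite divr_gt0.
move=> e1 e2 e1_ge0 e2_gt0 e12 he1 _ delta delta0.
have rho_e1 : rho < e1 by move: he1; rewrite ltr_norml => /andP[]; lra.
have p0 : 0 < p by exact: lt_trans hp.
(* [1 - t] is the feasible point; it is nonnegative and within [delta] of 1. *)
pose t := Num.min delta (1 / 2).
have t0 : 0 < t by rewrite lt_min delta0 divr_gt0.
have t_delta : t <= delta by rewrite ge_min lexx.
have t_half : t <= 1 / 2 by rewrite ge_min lexx orbT.
(* Two gaps of width [s] leave the thresholds [1 - t - 2 s] and
   [- (1 - t) - 2 s] above [-1], the value of [- xi2] under [P0] and the value
   of [xi1] that has mass [1 - rho]. *)
pose s := t / 4; have s0 : 0 < s by rewrite divr_gt0.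
(* [k] is the transport error that both constraints tolerate. *)
pose k := Num.min (e1 - rho) e2.
have k0 : 0 < k by rewrite lt_min subr_gt0 rho_e1.
have k1 : k <= e1 - rho by rewrite ge_min lexx.
have k2 : k <= e2 by rewrite ge_min lexx orbT.
apply: near_with_probability hcover _.
have : \forall N \near \oo, theta N <= k / 2 * s.
  by apply: cvgr_le htheta0 _ _; rewrite mulr_gt0 // divr_gt0.
apply: filterS => N thN w /= cover.
have th_k : theta N / s + theta N / s <= k.
  by move: thN; rewrite -ler_pdivrMr // => ?; lra.
apply: (@exact_of_feasible _ _ _ _ _ _ (1 - t)) => //; first by lra.
apply: bonferroni_feasible_tails; first by lra.
- move=> P FP.
  apply: le_trans (ball_superlevel (f := fst) (1 - t) s0 _ _ FP cover) _ => //.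
    exact: nonexpansive_fst p0.
  apply: le_trans (leeD2r _ (two_point_fst hP0_2 _)) _; first by rewrite /s; lra.
  by rewrite -EFinD lee_fin; lra.
- move=> P FP.
  apply: le_trans (ball_superlevel (f := fun a => - a.2)
    (- (1 - t)) s0 _ _ FP cover) _.
  - exact: measurable_funN.
  - exact: nonexpansiveN_snd p0.
  rewrite (two_point_snd hP0_1 hP0_2) ?add0e; last by rewrite /s; lra.
  by rewrite lee_fin; lra.
Qed.
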